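(* Let $M$ be a smooth oriented surface in $E^3$ without umbilic points and without critical points of its mean curvature function $H$, with principal coframe $\omega_1,\omega_2$ and with $A>0$, $\psi$ (a local smooth angle function), $\vartheta_i$, $\alpha_i$ as defined in the context. Let $\omega_{12},\vartheta_{12},\alpha_{12}$ be the connection forms associated to the coframes $(\omega_1,\omega_2)$, $(\vartheta_1,\vartheta_2)$, $(\alpha_1,\alpha_2)$ respectively. Then $$\vartheta_{12} = d\psi + \omega_{12} + *\,d\log A = 2\,d\psi + \alpha_{12}.$$
   Context: Connection form: for linearly independent one-forms $\eta_1,\eta_2$ on a surface, the associated connection form $\eta_{12}$ is the unique one-form with $d\eta_1=\eta_{12}\wedge\eta_2$, $d\eta_2=\eta_1\wedge\eta_{12}$. The surface $M$ carries an orthonormal frame $e_1,e_2,e_3$ with $e_3$ the unit normal and $e_1,e_2$ along principal directions; $\omega_1,\omega_2$ is the coframe dual to $e_1,e_2$ and $\omega_{12}=h\omega_1+k\omega_2$ its connection form. The principal curvatures are $a>c$ (so $\omega_{13}=a\omega_1$, $\omega_{23}=c\omega_2$), $H=\frac12(a+c)$, $J=\frac12(a-c)>0$. By the Codazzi equations there are functions $u,v$ with $\frac{1}{a-c}da-h\omega_2=(u-k)\omega_1$ and $\frac1{a-c}dc-k\omega_1=(v-h)\omega_2$; in particular $dH=J(u\omega_1+v\omega_2)$. The Hodge operator is $*\omega_1=\omega_2$, $*\omega_2=-\omega_1$. Set $A=\sqrt{u^2+v^2}>0$ (positive since $dH\neq0$), and let $\psi$ be a local smooth function with $u=A\cos\psi$,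 $v=A\sin\psi$. Define $\vartheta_1=u\omega_1+v\omega_2$, $\vartheta_2=-v\omega_1+u\omega_2$, $\alpha_1=u\omega_1-v\omega_2$, $\alpha_2=v\omega_1+u\omega_2$. *)

(* Defs.v *)
From HB Require Import structures.
From mathcomp Require Import all_boot all_order all_algebra.
From mathcomp Require Import all_classical all_reals all_analysis.
Set Implicit Arguments.
Unset Strict Implicit.
Unset Printing Implicit Defensive.
Import Order.TTheory GRing.Theory Num.Theory.
Import numFieldNormedType.Exports.
Local Open Scope classical_set_scope.
Local Open Scope ring_scope.

(** A surface in E^3 is a topological space [M] with a map [x : M -> E^3] which,
    in suitable local coordinates, is a smooth immersion.  Tangent vectors of
    [M] are identified with their images in E^3 under the differential of [x].
    Differential forms are given by their pullbacks to all charts. *)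

Section Smooth.
Variables (R : realType) (V : normedModType R).

(** C^oo on the open set [U]: every iterated partial derivative is
    differentiable (hence continuous) at every point of [U]. *)
Definition smooth_on (U : set 'rV[R]_2) (f : 'rV[R]_2 -> V) : Prop :=
  forall (s : seq 'I_2) (q : 'rV[R]_2), U q ->
    differentiable
      (foldr (fun i (g : 'rV[R]_2 -> V) p => 'D_(delta_mx 0 i) g p) f s) q.

End Smooth.

Section Charts.
Variables (R : realType) (M : topologicalType) (x : M -> 'rV[R]_3).

(** Local parametrizations [phi : U -> M]: homeomorphisms from an open
    set [U] of R^2 onto an open subset of [M] such that [x \o phi] is a smooth
    immersion.  A change of parameters between two of them is continuous and
    commutes with immersions, hence is smooth: they form a smooth atlas. *)
Record chart := Chart {
  dom : set 'rV[R]_2;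
  param :> 'rV[R]_2 -> M;
  dom_open : open dom;
  param_continuous : forall q, dom q -> {for q, continuous param};
  param_inj : set_inj dom param;
  param_open : forall A : set 'rV[R]_2,
    open A -> A `<=` dom -> open (param @` A);
  param_smooth : smooth_on dom (x \o param);
  param_immersion : forall q, dom q ->
    injective (fun w => 'D_w (x \o param) q) }.

Definition immersed_surface : Prop :=
  [/\ hausdorff_space M, @second_countable M &
      forall m : M, exists phi : chart, exists2 q, dom phi q & phi q = m].

Definition smooth_map (V : normedModType R) (W : set M) (f : M -> V) : Prop :=
  forall phi : chart, smooth_on (dom phi `&` phi @^-1` W) (f \o phi).

End Charts.

Section Forms.
Variables (R : realType) (M : topologicalType) (x : M -> 'rV[R]_3).

(** [eta phi q w] is the value at the point [q] and the vector [w] of the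
    pullback of the [V]-valued one-form [eta] by the chart [phi]; similarly for
    two-forms. *)
Definition form1 (V : normedModType R) : Type :=
  chart x -> 'rV[R]_2 -> 'rV[R]_2 -> V.
Definition form2 : Type :=
  chart x -> 'rV[R]_2 -> 'rV[R]_2 -> 'rV[R]_2 -> R.

HB.instance Definition _ (V : normedModType R) :=
  GRing.Lmodule.on (form1 V).

Definition differential (V : normedModType R) (f : M -> V) : form1 V :=
  fun phi q w => 'D_w (f \o phi) q.

Local Notation d := differential.

(** A family of pullbacks comes from a smooth one-form on [M]: each is linear
    and smooth, and two of them agree on the coordinate expressions [v], [w] of
    one tangent vector. *)
Definition is_form1 (eta : form1 R) : Prop :=
  [/\ forall (phi psi : chart x) q r v w,
        dom phi q -> dom psi r -> phi q = psi r ->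
        d x phi q v = d x psi r w -> eta phi q v = eta psi r w,
      forall (phi : chart x) q (k : R) v w, dom phi q ->
        eta phi q (k *: v + w) = k * eta phi q v + eta phi q w &
      forall (phi : chart x) w, smooth_on (dom phi) (fun q => eta phi q w)].

Definition form1_eq (W : set M) (eta theta : form1 R) : Prop :=
  forall (phi : chart x) q w, dom phi q -> W (phi q) ->
    eta phi q w = theta phi q w.

Definition form2_eq (W : set M) (eta theta : form2) : Prop :=
  forall (phi : chart x) q v w, dom phi q -> W (phi q) ->
    eta phi q v w = theta phi q v w.

Definition scale_form (f : M -> R) (eta : form1 R) : form1 R :=
  fun phi q w => f (phi q) * eta phi q w.

Definition wedge (eta theta : form1 R) : form2 :=
  fun phi q v w =>
    eta phi q v * theta phi q w - eta phi q w * theta phi q v.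

(** [d eta (v, w) = v (eta w) - w (eta v)] for the commuting coordinate fields
    [v], [w]. *)
Definition ext_deriv (eta : form1 R) : form2 :=
  fun phi q v w =>
    'D_v (fun p => eta phi p w) q - 'D_w (fun p => eta phi p v) q.

Definition is_connection_form (eta1 eta2 eta12 : form1 R) : Prop :=
  [/\ is_form1 eta12,
      form2_eq setT (ext_deriv eta1) (wedge eta12 eta2) &
      form2_eq setT (ext_deriv eta2) (wedge eta1 eta12)].

(** The component functions, in each chart, of [eta = f w1 + g w2], from
    [wedge eta w2 = f (wedge w1 w2)] and [wedge w1 eta = g (wedge w1 w2)]. *)
Definition coef1 (w1 w2 eta : form1 R) (phi : chart x) (q : 'rV[R]_2) : R :=
  let b i : 'rV[R]_2 := delta_mx 0 i in
  wedge eta w2 phi q (b 0) (b 1) / wedge w1 w2 phi q (b 0) (b 1).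

Definition coef2 (w1 w2 eta : form1 R) (phi : chart x) (q : 'rV[R]_2) : R :=
  let b i : 'rV[R]_2 := delta_mx 0 i in
  wedge w1 eta phi q (b 0) (b 1) / wedge w1 w2 phi q (b 0) (b 1).

(** The operator linear over functions with [* w1 = w2] and [* w2 = - w1]. *)
Definition hodge (w1 w2 eta : form1 R) : form1 R :=
  fun phi q w =>
    coef1 w1 w2 eta phi q * w2 phi q w - coef2 w1 w2 eta phi q * w1 phi q w.

Lemma hodge_coframe (w1 w2 : form1 R) (phi : chart x) (q w : 'rV[R]_2) :
  wedge w1 w2 phi q (delta_mx 0 0) (delta_mx 0 1) != 0 ->
  hodge w1 w2 w1 phi q w = w2 phi q w /\
  hodge w1 w2 w2 phi q w = - w1 phi q w.
Proof.
have wedge0 (eta : form1 R) v1 v2 : wedge eta eta phi q v1 v2 = 0.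
  by rewrite /wedge mulrC subrr.
move=> nz; rewrite /hodge /coef1 /coef2 !wedge0 divff //.
by rewrite !mul0r !mul1r subr0 sub0r.
Qed.

End Forms.

Notation "f ':*:' eta" := (scale_form f eta)
  (at level 40, left associativity) : ring_scope.

Section Surface.
Variables (R : realType) (M : topologicalType) (x : M -> 'rV[R]_3).

Local Notation d := (@differential R M x _).

Definition dot (v w : 'rV[R]_3) : R := \sum_i v 0 i * w 0 i.

(** The tangent plane at [phi q] does not depend on the chart [phi]. *)
Definition tangent_field (e : M -> 'rV[R]_3) : Prop :=
  forall (phi : chart x) q, dom phi q -> exists w, d x phi q w = e (phi q).

Definition unit_normal (n : M -> 'rV[R]_3) : Prop :=
  [/\ smooth_map x setT n,
      forall m, dot (n m) (n m) = 1 &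
      forall (phi : chart x) q w, dom phi q ->
        dot (d x phi q w) (n (phi q)) = 0].

(** [e1], [e2] is an orthonormal tangent frame, positively oriented for the
    orientation of the surface given by the unit normal [n]. *)
Definition oriented_frame (n e1 e2 : M -> 'rV[R]_3) : Prop :=
  [/\ smooth_map x setT e1 /\ smooth_map x setT e2,
      tangent_field e1 /\ tangent_field e2,
      forall m, [/\ dot (e1 m) (e1 m) = 1, dot (e2 m) (e2 m) = 1 &
                    dot (e1 m) (e2 m) = 0] &
      forall m, 0 < \det (col_mx (e1 m) (col_mx (e2 m) (n m)) : 'M[R]_3)].

(** [eta (e) = f], for a tangent field [e]. *)
Definition form_value (eta : form1 x R) (e : M -> 'rV[R]_3) (f : M -> R) :
    Prop :=
  forall (phi : chart x) q w, dom phi q -> d x phi q w = e (phi q) ->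
    eta phi q w = f (phi q).

Definition dual_coframe (e1 e2 : M -> 'rV[R]_3) (w1 w2 : form1 x R) : Prop :=
  [/\ is_form1 w1 /\ is_form1 w2,
      form_value w1 e1 (cst 1), form_value w1 e2 (cst 0),
      form_value w2 e1 (cst 0) & form_value w2 e2 (cst 1)].

(** [e] is an eigenvector of the shape operator [- dn], with eigenvalue [k]. *)
Definition principal_direction (n e : M -> 'rV[R]_3) (k : M -> R) : Prop :=
  forall (phi : chart x) q w, dom phi q -> d x phi q w = e (phi q) ->
    - d n phi q w = k (phi q) *: e (phi q).

Definition umbilic (n : M -> 'rV[R]_3) (m : M) : Prop :=
  exists k : R, forall (phi : chart x) q w, dom phi q -> phi q = m ->
    - d n phi q w = k *: d x phi q w.

Definition critical_point (f : M -> R) (m : M) : Prop :=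
  forall (phi : chart x) q w, dom phi q -> phi q = m -> d f phi q w = 0.

End Surface.

(* Main.v *)
(** Put [L = log A], [w = w1 + i w2] and [theta = theta1 + i theta2].  The
    structure equations of [w] read [d w = - i w12 /\ w], and
    [theta = exp (L - i psi) w]; since [* w = - i w], the term [d L /\ theta]
    equals [- i * d L /\ theta], so [d psi + w12 + * d L] satisfies the
    structure equations of [theta].  Those determine the connection form
    because [theta1 /\ theta2 = A^2 w1 /\ w2] vanishes nowhere: the Codazzi
    equations give [dH = J (u w1 + v w2)], hence [A > 0].  Replacing [(v, psi)]
    by [(- v, - psi)] turns [theta] into [alpha1 + i alpha2]. *)

Require Import Defs.
From HB Require Import structures.
From mathcomp Require Import all_boot all_order all_algebra.
From mathcomp Require Import all_classical all_reals all_analysis.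
From mathcomp Require Import ring lra.
Set Implicit Arguments.
Unset Strict Implicit.
Unset Printing Implicit Defensive.
Import Order.TTheory GRing.Theory Num.Theory.
Import numFieldNormedType.Exports.
Local Open Scope classical_set_scope.
Local Open Scope ring_scope.

(** * Derivatives of functions given in polar form *)

Section Calculus.
Variables (R : realType) (V : normedModType R).

Lemma differentiable_comp_scalar (f : V -> R) (g : R -> R) (q : V) (dg : R) :
  differentiable f q -> is_derive (f q) 1 g dg -> differentiable (g \o f) q.
Proof.
move=> df [dg1 _]; apply: differentiable_comp => //.
exact/derivable1_diffP.
Qed.

Lemma derive_comp_scalar (f : V -> R) (g : R -> R) (q w : V) (dg : R) :
  differentiable f q -> is_derive (f q) 1 g dg ->
  'D_w (g \o f) q = dg * 'D_w f q.
Proof.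
move=> df dg1; rewrite deriveE; last exact: (differentiable_comp_scalar df dg1).
case: dg1 => /derivable1_diffP dg1 <-.
by rewrite diff_comp // diff1E //= derive1E !deriveE // [RHS]mulrC.
Qed.

(** These are the real and imaginary parts of [d (f + i g) = (f + i g) (d L + i d P)] for
    [f + i g = exp (L + i P)]. The polar form is assumed near [q], since its value at [q] alone says
    nothing about derivatives. *)
Lemma derive_polar (f g P L : V -> R) (q : V) :
  differentiable f q -> differentiable g q ->
  differentiable P q -> differentiable L q ->
  (\near q, f q = expR (L q) * cos (P q)) ->
  (\near q, g q = expR (L q) * sin (P q)) ->
  forall w, 'D_w f q = f q * 'D_w L q - g q * 'D_w P q /\
            'D_w g q = g q * 'D_w L q + f q * 'D_w P q.
Proof.
move=> df dg dP dL fE gE w.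
have fq := nbhs_singleton fE; have gq := nbhs_singleton gE.
have dexp := differentiable_comp_scalar dL (is_derive_expR (L q)).
have dcos := differentiable_comp_scalar dP (is_derive_cos (P q)).
have dsin := differentiable_comp_scalar dP (is_derive_sin (P q)).
split.
  rewrite (near_eq_derive (g := (expR \o L) * (cos \o P))) //.
  rewrite deriveM; try exact: diff_derivable.
  rewrite (derive_comp_scalar w dL (is_derive_expR (L q))).
  rewrite (derive_comp_scalar w dP (is_derive_cos (P q))).
  by rewrite fq gq /GRing.scale /=; ring.
rewrite (near_eq_derive (g := (expR \o L) * (sin \o P))) //.
rewrite deriveM; try exact: diff_derivable.
rewrite (derive_comp_scalar w dL (is_derive_expR (L q))).
rewrite (derive_comp_scalar w dP (is_derive_sin (P q))).
by rewrite fq gq /GRing.scale /=; ring.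
Qed.

Lemma differentiable_ln_modulus (f g : V -> R) (q : V) :
  differentiable f q -> differentiable g q -> 0 < f q ^+ 2 + g q ^+ 2 ->
  differentiable (fun p => ln (Num.sqrt (f p ^+ 2 + g p ^+ 2))) q.
Proof.
move=> df dg pos.
have dS : differentiable (fun p => f p ^+ 2 + g p ^+ 2) q.
  rewrite (_ : (fun p => _) = f * f + g * g); last first.
    by apply/funext => p; rewrite !expr2.
  by apply: differentiableD; apply: differentiableM.
have dA : differentiable (Num.sqrt \o (fun p => f p ^+ 2 + g p ^+ 2)) q.
  exact: differentiable_comp_scalar dS (is_derive1_sqrt pos).
apply: (differentiable_comp_scalar dA (is_derive1_ln _)).
by rewrite /= sqrtr_gt0.
Qed.

End Calculus.

(** * Linear algebra of one-forms in the plane *)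

Section LinearForms.
Variables (R : realType).
Implicit Types l : 'rV[R]_2 -> R.

Local Notation b i := (delta_mx 0 i : 'rV[R]_2).

Lemma linear_form_basis l (w : 'rV[R]_2) :
  (forall k v1 v2, l (k *: v1 + v2) = k * l v1 + l v2) ->
  l w = w 0 0 * l (b 0) + w 0 1 * l (b 1).
Proof.
move=> lin.
have l0 : l 0 = 0 by have := lin 1 0 0; rewrite scaler0 addr0; lra.
have lZ k v : l (k *: v) = k * l v.
  by rewrite -[RHS]addr0 -l0 -lin addr0.
rewrite {1}(row_sum_delta w) big_ord_recl big_ord1.
rewrite (_ : lift _ _ = 1); last exact/val_inj.
transitivity (w 0 0 * l (b 0) + l (w 0 1 *: b 1)); first exact: lin.
by rewrite lZ.
Qed.

(** The matrix of values of [l1], [l2] on [v1], [v2] is the identity. It is also the product of the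
    coefficient matrix of the forms and the coordinate matrix of the vectors, so the two
    determinants multiply to 1. *)
Lemma linear_forms_det_neq0 l1 l2 (v1 v2 : 'rV[R]_2) :
  (forall k w1 w2, l1 (k *: w1 + w2) = k * l1 w1 + l1 w2) ->
  (forall k w1 w2, l2 (k *: w1 + w2) = k * l2 w1 + l2 w2) ->
  l1 v1 = 1 -> l1 v2 = 0 -> l2 v1 = 0 -> l2 v2 = 1 ->
  l1 (b 0) * l2 (b 1) - l1 (b 1) * l2 (b 0) != 0.
Proof.
move=> lin1 lin2.
rewrite (linear_form_basis v1 lin1) (linear_form_basis v2 lin1).
rewrite (linear_form_basis v1 lin2) (linear_form_basis v2 lin2).
move=> e11 e12 e21 e22; apply/eqP => det0.
have : (l1 (b 0) * l2 (b 1) - l1 (b 1) * l2 (b 0)) *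
       (v1 0 0 * v2 0 1 - v1 0 1 * v2 0 0) =
       (v1 0 0 * l1 (b 0) + v1 0 1 * l1 (b 1)) *
       (v2 0 0 * l2 (b 0) + v2 0 1 * l2 (b 1)) -
       (v2 0 0 * l1 (b 0) + v2 0 1 * l1 (b 1)) *
       (v1 0 0 * l2 (b 0) + v1 0 1 * l2 (b 1)) by ring.
rewrite det0 e11 e12 e21 e22; lra.
Qed.

(** [T] plays the difference of two connection forms of [theta1 = f w1 + g w2],
    [theta2 = - g w1 + f w2]: the equations say [T /\ theta2 = 0] and [theta1 /\ T = 0]. By Cramer's
    rule each coordinate of [T] is killed by the determinant of [theta1 /\ theta2], which is the
    product of the two nonzero factors. *)
Lemma cartan_system_unique (T0 T1 f g p0 p1 q0 q1 : R) :
  f ^+ 2 + g ^+ 2 != 0 -> p0 * q1 - p1 * q0 != 0 ->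
  T0 * (- (g * p1) + f * q1) - T1 * (- (g * p0) + f * q0) = 0 ->
  (f * p0 + g * q0) * T1 - (f * p1 + g * q1) * T0 = 0 ->
  T0 = 0 /\ T1 = 0.
Proof.
move=> fg0 pq0 sys1 sys2; split;
  apply: (mulfI (mulf_neq0 fg0 pq0)); rewrite mulr0.
  transitivity (
    (T0 * (- (g * p1) + f * q1) - T1 * (- (g * p0) + f * q0)) *
      (f * p0 + g * q0) +
    ((f * p0 + g * q0) * T1 - (f * p1 + g * q1) * T0) *
      (- (g * p0) + f * q0)); first ring.
  by rewrite sys1 sys2; ring.
transitivity (
  (T0 * (- (g * p1) + f * q1) - T1 * (- (g * p0) + f * q0)) *
    (f * p1 + g * q1) +
  ((f * p0 + g * q0) * T1 - (f * p1 + g * q1) * T0) *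
    (- (g * p1) + f * q1)); first ring.
by rewrite sys1 sys2; ring.
Qed.

(* Here [p], [q], [m], [t], [P] are the coordinates of [w1], [w2], [w12],
   [t12], [d P], those of [d L] are the coordinates of [c1 w1 + c2 w2], and
   [Xij], [Yij] are the derivatives along [b i] of the coordinates [j] of [w1]
   and [w2]. *)
Lemma rotated_cartan_system
    (f g p0 p1 q0 q1 m0 m1 t0 t1 P0 P1 c1 c2 X01 X10 Y01 Y10 : R) :
  let L0 := c1 * p0 + c2 * q0 in
  let L1 := c1 * p1 + c2 * q1 in
  f ^+ 2 + g ^+ 2 != 0 -> p0 * q1 - p1 * q0 != 0 ->
  X01 - X10 = m0 * q1 - m1 * q0 -> Y01 - Y10 = p0 * m1 - p1 * m0 ->
  f * X01 + p1 * (f * L0 - g * P0) + (g * Y01 + q1 * (g * L0 + f * P0)) -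
  (f * X10 + p0 * (f * L1 - g * P1) + (g * Y10 + q0 * (g * L1 + f * P1))) =
  t0 * (- (g * p1) + f * q1) - t1 * (- (g * p0) + f * q0) ->
  - (g * X01 + p1 * (g * L0 + f * P0)) + (f * Y01 + q1 * (f * L0 - g * P0)) -
  (- (g * X10 + p0 * (g * L1 + f * P1)) + (f * Y10 + q0 * (f * L1 - g * P1))) =
  (f * p0 + g * q0) * t1 - (f * p1 + g * q1) * t0 ->
  t0 = P0 + m0 + (c1 * q0 - c2 * p0) /\ t1 = P1 + m1 + (c1 * q1 - c2 * p1).
Proof.
move=> L0 L1 fg0 pq0 /(canRL (subrK _)) eX /(canRL (subrK _)) eY sys1 sys2.
(* The coordinates of the expected form [d P + w12 + c1 w2 - c2 w1]. It solves the same linear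
   system as [t], so [t - s] solves the homogeneous one. *)
pose s0 := P0 + m0 + (c1 * q0 - c2 * p0).
pose s1 := P1 + m1 + (c1 * q1 - c2 * p1).
suff [T0 T1] : t0 - s0 = 0 /\ t1 - s1 = 0.
  by split; apply/eqP; rewrite -subr_eq0; apply/eqP.
apply: (cartan_system_unique fg0 pq0).
  transitivity (t0 * (- (g * p1) + f * q1) - t1 * (- (g * p0) + f * q0) -
    (s0 * (- (g * p1) + f * q1) - s1 * (- (g * p0) + f * q0))); first by ring.
  by rewrite -sys1 eX eY /s0 /s1 /L0 /L1; ring.
transitivity ((f * p0 + g * q0) * t1 - (f * p1 + g * q1) * t0 -
  ((f * p0 + g * q0) * s1 - (f * p1 + g * q1) * s0)); first by ring.
by rewrite -sys2 eX eY /s0 /s1 /L0 /L1; ring.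
Qed.

End LinearForms.

(** * Connection form of a rotated and rescaled coframe *)

Section Connection.
Variables (R : realType) (M : topologicalType) (x : M -> 'rV[R]_3).

Local Notation b i := (delta_mx 0 i : 'rV[R]_2).

Lemma linear_form_ext (eta theta : 'rV[R]_2 -> R) (w : 'rV[R]_2) :
  (forall k v1 v2, eta (k *: v1 + v2) = k * eta v1 + eta v2) ->
  (forall k v1 v2, theta (k *: v1 + v2) = k * theta v1 + theta v2) ->
  eta (b 0) = theta (b 0) -> eta (b 1) = theta (b 1) -> eta w = theta w.
Proof.
move=> lin1 lin2 e0 e1.
by rewrite (linear_form_basis w lin1) (linear_form_basis w lin2) e0 e1.
Qed.

Lemma coframe_wedge_neq0 (e1 e2 : M -> 'rV[R]_3) (w1 w2 : form1 x R)
    (phi : chart x) q :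
  tangent_field x e1 -> tangent_field x e2 -> dual_coframe e1 e2 w1 w2 ->
  dom phi q -> wedge w1 w2 phi q (b 0) (b 1) != 0.
Proof.
move=> te1 te2 [[[_ lin1 _] [_ lin2 _]] v11 v12 v21 v22] dq.
have [E1 E1e] := te1 phi q dq; have [E2 E2e] := te2 phi q dq.
apply: (@linear_forms_det_neq0 _ _ _ E1 E2).
- by move=> k v w; exact: lin1.
- by move=> k v w; exact: lin2.
- exact: v11 dq E1e.
- exact: v12 dq E2e.
- exact: v21 dq E1e.
- exact: v22 dq E2e.
Qed.

Lemma derive_lincomb (V : normedModType R) (f g p r : V -> R) (q w : V) :
  differentiable f q -> differentiable g q ->
  differentiable p q -> differentiable r q ->
  'D_w (fun z => f z * p z + g z * r z) q =
  f q * 'D_w p q + p q * 'D_w f q + (g q * 'D_w r q + r q * 'D_w g q).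
Proof.
move=> df dg dp dr.
rewrite (_ : (fun z => _) = f * p + g * r) //.
by rewrite deriveD ?deriveM //; apply: diff_derivable => //;
  apply: differentiableM.
Qed.

(** Keeping [f], [g], [L], [P] general lets one computation serve both the [theta] and the [alpha]
    coframes. Both sides are linear in [w], so the basis vectors suffice, and there the structure
    equations become the scalar system of [rotated_cartan_system]. *)
Lemma rotated_connection_form (w1 w2 w12 t12 : form1 x R) (f g L P : M -> R)
    (phi : chart x) (q w : 'rV[R]_2) :
  dom phi q -> is_form1 w1 -> is_form1 w2 ->
  wedge w1 w2 phi q (b 0) (b 1) != 0 ->
  is_connection_form w1 w2 w12 ->
  is_connection_form (f :*: w1 + g :*: w2) (- (g :*: w1) + f :*: w2) t12 ->
  differentiable (f \o phi) q -> differentiable (g \o phi) q ->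
  differentiable (L \o phi) q -> differentiable (P \o phi) q ->
  (\near q, f (phi q) = expR (L (phi q)) * cos (P (phi q))) ->
  (\near q, g (phi q) = expR (L (phi q)) * sin (P (phi q))) ->
  t12 phi q w =
  (differential P + w12 + hodge w1 w2 (differential L)) phi q w.
Proof.
move=> dq [_ lin1 sm1] [_ lin2 sm2] D0 [[_ lin12 _] dw1 dw2]
  [[_ lint _] dt1 dt2] df dg dL dP fE gE.
have fg0 : f (phi q) ^+ 2 + g (phi q) ^+ 2 != 0.
  rewrite (nbhs_singleton fE) (nbhs_singleton gE) !exprMn -mulrDr cos2Dsin2.
  by rewrite mulr1 expf_neq0 // gt_eqF // expR_gt0.
have polar := derive_polar df dg dP dL fE gE.
have [/= f0 g0] := polar (b 0); have [/= f1 g1] := polar (b 1).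
(* The empty list of directions in [smooth_on] gives differentiability of the function itself. *)
have d1 i : differentiable (fun p => w1 phi p (b i)) q :=
  sm1 phi (b i) [::] q dq.
have d2 i : differentiable (fun p => w2 phi p (b i)) q :=
  sm2 phi (b i) [::] q dq.
(* A two-form in the plane is determined by its value on [b 0], [b 1], so each structure equation
   amounts to one scalar equation. *)
move: (dw1 phi q (b 0) (b 1) dq I) (dw2 phi q (b 0) (b 1) dq I).
move: (dt1 phi q (b 0) (b 1) dq I) (dt2 phi q (b 0) (b 1) dq I).
rewrite /ext_deriv /wedge.
have theta1_deriv i j :
  'D_(b i) (fun p => (f :*: w1 + g :*: w2) phi p (b j)) q =
  f (phi q) * 'D_(b i) (fun p => w1 phi p (b j)) q +
  w1 phi q (b j) * 'D_(b i) (f \o phi) q +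
  (g (phi q) * 'D_(b i) (fun p => w2 phi p (b j)) q +
  w2 phi q (b j) * 'D_(b i) (g \o phi) q).
  exact: (derive_lincomb (b i) df dg (d1 j) (d2 j)).
have theta2_deriv i j :
  'D_(b i) (fun p => (- (g :*: w1) + f :*: w2) phi p (b j)) q =
  - (g (phi q) * 'D_(b i) (fun p => w1 phi p (b j)) q +
  w1 phi q (b j) * 'D_(b i) (g \o phi) q) +
  (f (phi q) * 'D_(b i) (fun p => w2 phi p (b j)) q +
  w2 phi q (b j) * 'D_(b i) (f \o phi) q).
  (* The sign is moved into the coefficient, so that [derive_lincomb] applies with [- g] and [f]. *)
  have dNg : differentiable (- (g \o phi)) q by exact: differentiableN.
  rewrite (_ : (fun p => _) = fun p =>
    (- (g \o phi)) p * w1 phi p (b j) + f (phi p) * w2 phi p (b j)); last first.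
    by apply/funext => p; rewrite -mulNr.
  rewrite (derive_lincomb (b i) dNg df (d1 j) (d2 j)).
  rewrite deriveN; last exact: diff_derivable.
  by rewrite (_ : (- (g \o phi)) q = - g (phi q)) //=; ring.
rewrite !theta1_deriv !theta2_deriv f0 f1 g0 g1.
move=> {theta1_deriv theta2_deriv polar f0 f1 g0 g1 dt1 dt2 dw1 dw2}.
move=> sys1 sys2 sys3 sys4.
have P_lin k v1 v2 : 'D_(k *: v1 + v2) (P \o phi) q =
    k * 'D_v1 (P \o phi) q + 'D_v2 (P \o phi) q.
  by rewrite !deriveE // linearP.
pose mid w := 'D_w (P \o phi) q + w12 phi q w +
  hodge w1 w2 (differential L) phi q w.
suff mid_eq : t12 phi q (b 0) = mid (b 0) /\ t12 phi q (b 1) = mid (b 1).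
  apply: (@linear_form_ext (t12 phi q) mid) => [k v1 v2|k v1 v2||].
  - exact: lint.
  - by rewrite /mid /hodge P_lin lin12 // lin1 // lin2 //; ring.
  - by case: mid_eq.
  - by case: mid_eq.
(* The Hodge coefficients are Cramer quotients; as [D0] makes the denominator nonzero, they recover
   [d L] as a combination of [w1] and [w2]. *)
have Li : 'D_(b 0) (L \o phi) q =
       Defs.coef1 w1 w2 (differential L) phi q * w1 phi q (b 0) +
       coef2 w1 w2 (differential L) phi q * w2 phi q (b 0) /\
     'D_(b 1) (L \o phi) q =
       Defs.coef1 w1 w2 (differential L) phi q * w1 phi q (b 1) +
       coef2 w1 w2 (differential L) phi q * w2 phi q (b 1).
  move: D0; rewrite /Defs.coef1 /coef2 /wedge /differential => D0.
  by split; field.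
move: sys1 sys2; rewrite Li.1 Li.2.
exact: (rotated_cartan_system fg0 D0 sys3 sys4).
Qed.

End Connection.

(** * The Codazzi equations and the gradient of the mean curvature *)

Section Codazzi.
Variables (R : realType) (M : topologicalType) (x : M -> 'rV[R]_3).

(** In the sum of the two equations the [h] and [k] terms cancel, leaving
    [(a - c)^-1 (da + dc) = u w1 + v w2]. A common zero of [u] and [v] would thus be a critical
    point of the mean curvature. *)
Lemma codazzi_grad_gt0 (a c h k u v : M -> R) (w1 w2 : form1 x R) :
  smooth_map x setT a -> smooth_map x setT c ->
  (forall m, c m < a m) ->
  (forall m, ~ critical_point x (fun m => (a m + c m) / 2) m) ->
  form1_eq setT ((fun m => (a m - c m)^-1) :*: differential a - h :*: w2)
                ((fun m => u m - k m) :*: w1) ->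
  form1_eq setT ((fun m => (a m - c m)^-1) :*: differential c - k :*: w1)
                ((fun m => v m - h m) :*: w2) ->
  forall m, 0 < u m ^+ 2 + v m ^+ 2.
Proof.
move=> sa sc ca ncrit coda codc m; rewrite lt0r addr_ge0 ?sqr_ge0 // andbT.
apply/eqP => uv0; apply: (ncrit m) => phi q w dq phiq.
have um : u m = 0 by apply/eqP; rewrite -sqrf_eq0; nra.
have vm : v m = 0 by apply/eqP; rewrite -sqrf_eq0; nra.
have da : differentiable (a \o phi) q := sa phi [::] q (conj dq I).
have dc : differentiable (c \o phi) q := sc phi [::] q (conj dq I).
have ea : (a m - c m)^-1 * 'D_w (a \o phi) q - h m * w2 phi q w =
    (u m - k m) * w1 phi q w by rewrite -phiq; exact: (coda phi q w dq I).
have ec : (a m - c m)^-1 * 'D_w (c \o phi) q - k m * w1 phi q w =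
    (v m - h m) * w2 phi q w by rewrite -phiq; exact: (codc phi q w dq I).
have ac0 : (a m - c m)^-1 != 0 by rewrite invr_eq0 subr_eq0 gt_eqF.
rewrite /differential.
rewrite (_ : _ \o phi = 2^-1 \*o ((a \o phi) + (c \o phi))); last first.
  by apply/funext => p /=; rewrite mulrC.
rewrite deriveMl; last by apply: derivableD; exact: diff_derivable.
rewrite deriveD; [|exact: diff_derivable|exact: diff_derivable].
suff -> : 'D_w (a \o phi) q + 'D_w (c \o phi) q = 0 by rewrite mulr0.
apply: (mulfI ac0); rewrite mulr0.
by move: ea ec; rewrite um vm; lra.
Qed.

End Codazzi.

Theorem theorem4p2 (R : realType) (M : topologicalType) (x : M -> 'rV[R]_3)
    (e1 e2 e3 : M -> 'rV[R]_3) (a c : M -> R)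
    (w1 w2 w12 theta12 alpha12 : form1 x R) (h k u v : M -> R)
    (W : set M) (psi : M -> R) :
  let d := @differential R M x R in
  let H := fun m => (a m + c m) / 2 in
  let A := fun m => Num.sqrt (u m ^+ 2 + v m ^+ 2) in
  let theta1 := u :*: w1 + v :*: w2 in
  let theta2 := - (v :*: w1) + u :*: w2 in
  let alpha1 := u :*: w1 - v :*: w2 in
  let alpha2 := v :*: w1 + u :*: w2 in
  let star := hodge w1 w2 in
  immersed_surface x ->
  unit_normal x e3 ->
  (forall m, ~ umbilic x e3 m) ->
  oriented_frame x e3 e1 e2 ->
  smooth_map x setT a -> smooth_map x setT c ->
  (forall m, c m < a m) ->
  principal_direction x e3 e1 a -> principal_direction x e3 e2 c ->
  (forall m, ~ critical_point x H m) ->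
  dual_coframe e1 e2 w1 w2 ->
  is_connection_form w1 w2 w12 ->
  form1_eq setT w12 (h :*: w1 + k :*: w2) ->
  smooth_map x setT u -> smooth_map x setT v ->
  form1_eq setT ((fun m => (a m - c m)^-1) :*: d a - h :*: w2)
                ((fun m => u m - k m) :*: w1) ->
  form1_eq setT ((fun m => (a m - c m)^-1) :*: d c - k :*: w1)
                ((fun m => v m - h m) :*: w2) ->
  open W ->
  smooth_map x W psi ->
  (forall m, W m -> u m = A m * cos (psi m) /\ v m = A m * sin (psi m)) ->
  is_connection_form theta1 theta2 theta12 ->
  is_connection_form alpha1 alpha2 alpha12 ->
  let middle := d psi + w12 + star (d (fun m => ln (A m))) in
  form1_eq W theta12 middle /\ form1_eq W middle (2 *: d psi + alpha12).
Proof.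
move=> d H A theta1 theta2 alpha1 alpha2 star _ _ _ [_ [te1 te2] _ _] sa sc ca
  _ _ ncrit dual conn12 _ su sv coda codc openW spsi polar connt conna middle.
have uv_gt0 : forall m, 0 < u m ^+ 2 + v m ^+ 2.
  exact: codazzi_grad_gt0 sa sc ca ncrit coda codc.
have expA m : expR (ln (A m)) = A m by rewrite lnK // posrE sqrtr_gt0.
have [[form_w1 form_w2] _ _ _ _] := dual.
(* The [alpha] coframe is put in the shape required by [rotated_connection_form], with [- v] as
   second coefficient. *)
have alpha1E : alpha1 = u :*: w1 + (fun m => - v m) :*: w2.
  by apply/funext => phi; apply/funext => q; apply/funext => w; congr (_ + _);
    exact: esym (mulNr _ _).
have alpha2E : alpha2 = - ((fun m => - v m) :*: w1) + u :*: w2.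
  apply/funext => phi; apply/funext => q; apply/funext => w; congr (_ + _).
  by rewrite -[RHS]/(- (- v (phi q) * w1 phi q w)) mulNr opprK.
(* The two formulas differ only in the sign of [d psi], whence the term [2 d psi] in the
   conclusion. *)
have key (phi : chart x) q w : dom phi q -> W (phi q) ->
    theta12 phi q w = middle phi q w /\
    alpha12 phi q w = (- d psi + w12 + star (d (fun m => ln (A m)))) phi q w.
  move=> dq Wq.
  have du : differentiable (u \o phi) q := su phi [::] q (conj dq I).
  have dv : differentiable (v \o phi) q := sv phi [::] q (conj dq I).
  have dpsi : differentiable (psi \o phi) q := spsi phi [::] q (conj dq Wq).
  have dL : differentiable ((fun m => ln (A m)) \o phi) q.
    exact: differentiable_ln_modulus du dv (uv_gt0 (phi q)).
  (* The polar equations hold only on [W]; openness of [W] and continuity of the chart make them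
     hold near [q]. *)
  have nearW : \near q, W (phi q).
    exact: (param_continuous dq (open_nbhs_nbhs (conj openW Wq))).
  have wedge0 := coframe_wedge_neq0 te1 te2 dual dq.
  split.
    apply: (rotated_connection_form w dq form_w1 form_w2 wedge0 conn12 connt
      du dv dL dpsi); near=> p.
    - by rewrite expA; have [] := polar (phi p) _; first by near: p.
    - by rewrite expA; have [] := polar (phi p) _; first by near: p.
  rewrite alpha1E alpha2E in conna.
  have dNpsi : differentiable ((fun m => - psi m) \o phi) q.
    exact: differentiableN dpsi.
  have dNv : differentiable ((fun m => - v m) \o phi) q.
    exact: differentiableN dv.
  (* The angle is now [- psi]: [cos] is even and [sin] is odd, so [(u, - v)] has the same modulus
     and the opposite angle. *)
  have -> := rotated_connection_form w dq form_w1 form_w2 wedge0 conn12 conna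
    du dNv dL dNpsi.
  - congr (_ + _ + _).
    exact: (deriveN (diff_derivable dpsi)).
  - near=> p; rewrite expA cosN.
    by have [] := polar (phi p) _; first by near: p.
  - near=> p; rewrite expA sinN mulrN; congr (- _).
    by have [] := polar (phi p) _; first by near: p.
split=> phi q w dq Wq; first by have [] := key phi q w dq Wq.
rewrite -[RHS]/(2 * d psi phi q w + alpha12 phi q w).
have [_ ->] := key phi q w dq Wq.
rewrite -[LHS]/(d psi phi q w + w12 phi q w +
  star (d (fun m => ln (A m))) phi q w).
rewrite -[X in _ = _ + X]/(- d psi phi q w + w12 phi q w +
  star (d (fun m => ln (A m))) phi q w).
by ring.
Unshelve. all: by end_near.
Qed.
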